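(* Let $d\ge1$, let $k(x,y)=e^{-\sigma\|x-y\|_2^2}$ be the Gaussian kernel on $[0,1]^d$ with $\sigma>0$, and let $P$ be a probability measure on $[0,1]^d$ with density $p$ satisfying $0<p_{\min}:=\inf p\le p_{\max}:=\sup p<\infty$. Let $\mu_1\ge\mu_2\ge\dots$ and $\varphi_1,\varphi_2,\dots$ be the eigenvalues and eigenfunctions in the Mercer decomposition of $k$. Let $C(d,\sigma)>0$ and $c_{d,\sigma}>0$ be constants depending on $d$ and $\sigma$ such that $$\mu_\ell\ge\frac{p_{\min}^2}{p_{\max}^2}C(d,\sigma)\,e^{-c_{d,\sigma}(\ell+d)^{2/d}},\qquad\ell=1,2,\dots.$$ Then for every $\ell\in\mathbb{N}$, $$\max_{x\in[0,1]^d}|\varphi_\ell(x)|\le\sqrt{18c_p}\,\max\big\{h(\ell),\ (3c_\sigma e+2)^d,\ (3c_\sigma(d\cdot c)+2)^d\big\}+\sqrt2$$ with $$h(\ell)=\left(3c_\sigma\Big(\tfrac12\ln 9-\tfrac12\ln\Big(\frac{p_{\min}^2}{p_{\max}^2}C(d,\sigma)\Big)+\tfrac12c_{d,\sigma}(\ell+d)^{2/d}\Big)_++2\right)^d.$$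
   Context: The $\varphi_\ell$ are the continuous, $L^2([0,1]^d,P)$-orthonormal eigenfunctions, with eigenvalues $\mu_\ell$ in non-increasing order (with multiplicity), of the operator $(L_kf)(y)=\int_{[0,1]^d}k(z,y)f(z)p(z)\,dz$ on $L^2([0,1]^d,P)$, so that $k(x,y)=\sum_{\ell\ge1}\mu_\ell\varphi_\ell(x)\varphi_\ell(y)$. The paper establishes in a separate lemma that constants $C(d,\sigma)$, $c_{d,\sigma}$ with the stated lower bound exist. $x_+=\max\{x,0\}$ is the positive part. Constants: $c_\sigma=\max\{1,2e\sigma d\}$, $c_p=\sup_{z\in[0,1]^d}p(z)^{-1}$ and $c=\max\{c_0,c_1,c_2,1\}$ with $$c_0=\frac{\ln 3+(d-1)\ln2+\frac12\ln c_p+d\ln(3c_\sigma d)}{2d\ln3},\quad c_1=\frac{(2d-1)\ln2+d\ln(3c_\sigma)+\frac12\ln c_p}{d}+1,\quad c_2=\frac{(2d-1)\ln2+\frac12\ln c_p}{d}.$$ *)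

(* Defs.v *)
From HB Require Import structures.
Set Warnings "-all".
From mathcomp Require Import all_boot all_order all_algebra.
From mathcomp Require Import all_classical all_reals all_analysis.

Set Implicit Arguments.
Unset Strict Implicit.
Unset Printing Implicit Defensive.

Import Order.TTheory GRing.Theory Num.Theory.
Import numFieldNormedType.Exports.

Local Open Scope classical_set_scope.
Local Open Scope ring_scope.

(* Points of R^d are row vectors 'rV[R]_d: the library gives them the product
   topology, but no sigma-algebra.  As for tuples, we take the one generated by
   the coordinates; over R it is the Borel sigma-algebra of R^d. *)
Definition measure_rV_display : measure_display -> measure_display.
Proof. exact. Qed.

Section measurable_rV.
Context {d} {T : sigmaRingType d}.
Variable n : nat.

Let coors : 'I_n -> 'rV[T]_n -> T := fun i x => x ord0 i.

Let rV_set0 : g_sigma_preimage coors set0.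
Proof. exact: sigma_algebra0. Qed.

Let rV_setC A : g_sigma_preimage coors A -> g_sigma_preimage coors (~` A).
Proof. exact: sigma_algebraC. Qed.

Let rV_bigcup (F : _^nat) : (forall i, g_sigma_preimage coors (F i)) ->
  g_sigma_preimage coors (\bigcup_i (F i)).
Proof. exact: sigma_algebra_bigcup. Qed.

HB.instance Definition _ := @isMeasurable.Build (measure_rV_display d)
  'rV[T]_n (g_sigma_preimage coors) rV_set0 rV_setC rV_bigcup.

End measurable_rV.

Lemma measurable_rV_coord d (T : sigmaRingType d) n (i : 'I_n) :
  measurable_fun [set: 'rV[T]_n] (fun x : 'rV[T]_n => x ord0 i).
Proof.
move=> _ Y mY; rewrite setTI; apply: sub_sigma_algebra => /=.
rewrite -bigcup_seq/=; exists i => /=; first by rewrite mem_index_enum.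
by exists Y => //; rewrite setTI.
Qed.

Lemma measurable_fun_rVP d1 d2 (T1 : measurableType d1) (T2 : sigmaRingType d2)
    n (f : T1 -> 'rV[T2]_n) :
  (forall i, measurable_fun [set: T1] (fun x => f x ord0 i)) ->
  measurable_fun [set: T1] f.
Proof.
move=> mf _ A mA; rewrite setTI.
pose S : set (set 'rV[T2]_n) := [set B | measurable (f @^-1` B)].
suff : S A by [].
move: A mA; apply: smallest_sub.
  split.
  - by rewrite /S/= preimage_set0.
  - move=> B SB; rewrite /S/= setTD preimage_setC.
    exact: measurableC.
  - move=> F SF; rewrite /S/= preimage_bigcup.
    exact: bigcupT_measurable.
rewrite -bigcup_seq => B [i _ [C mC <-]].
by rewrite /S/= setTI -[X in measurable X]setTI; exact: mf.
Qed.

Section lebesgue_rV.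
Context {R : realType}.

Definition cons_rV n (xy : R * 'rV[R]_n) : 'rV[R]_n.+1 :=
  row_mx (xy.1)%:M xy.2 : 'rV[R]_(1 + n).

Lemma cons_rV0 n (xy : R * 'rV[R]_n) : cons_rV xy ord0 ord0 = xy.1.
Proof.
rewrite (_ : ord0 = @lshift 1 n ord0); last exact/val_inj.
by apply: (etrans (row_mxEl _ _ _ _)); rewrite mxE eqxx mulr1n.
Qed.

Lemma cons_rVS n (xy : R * 'rV[R]_n) (j : 'I_n) :
  cons_rV xy ord0 (lift ord0 j) = xy.2 ord0 j.
Proof.
rewrite (_ : lift ord0 j = @rshift 1 n j); last exact/val_inj.
exact: row_mxEr.
Qed.

Lemma measurable_cons_rV n : measurable_fun setT (@cons_rV n).
Proof.
apply: measurable_fun_rVP => i; have [j ->|->] := unliftP ord0 i.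
  under eq_fun do rewrite cons_rVS.
  exact: measurableT_comp (measurable_rV_coord _) measurable_snd.
by under eq_fun do rewrite cons_rV0; exact: measurable_fst.
Qed.

Section step.
Variables (n : nat) (m : {sigma_finite_measure set 'rV[R]_n -> \bar R}).

Definition lebesgue_rV_step : set 'rV[R]_n.+1 -> \bar R :=
  pushforward (lebesgue_measure \x m)%E (@cons_rV n).

Let step0 : lebesgue_rV_step set0 = 0%E.
Proof. by rewrite /lebesgue_rV_step /pushforward preimage_set0 measure0. Qed.

Let step_ge0 A : (0 <= lebesgue_rV_step A)%E.
Proof. by rewrite /lebesgue_rV_step /pushforward measure_ge0. Qed.

Let step_sigma_additive : semi_sigma_additive lebesgue_rV_step.
Proof.
move=> F mF tF mUF; rewrite /lebesgue_rV_step /pushforward preimage_bigcup.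
have mpre A : measurable A -> measurable (@cons_rV n @^-1` A).
  by move=> mA; rewrite -[X in measurable X]setTI; exact: measurable_cons_rV.
apply: measure_semi_sigma_additive.
- by move=> i; exact: mpre.
- apply/trivIsetP => /= i j _ _ ij; rewrite -preimage_setI.
  by move/trivIsetP : tF => /(_ _ _ _ _ ij) ->//; rewrite preimage_set0.
- by rewrite -preimage_bigcup; exact: mpre.
Qed.

HB.instance Definition _ := isMeasure.Build _ _ _ lebesgue_rV_step
  step0 step_ge0 step_sigma_additive.

Let uncons (z : 'rV[R]_n.+1) : R * 'rV[R]_n :=
  (z ord0 ord0, \row_j z ord0 (lift ord0 j)).

Let uncons_cons : cancel (@cons_rV n) uncons.
Proof.
case=> x y; rewrite /uncons cons_rV0/=; congr pair.
by apply/rowP => j; rewrite mxE cons_rVS.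
Qed.

Let measurable_uncons : measurable_fun setT uncons.
Proof.
apply/measurable_fun_pairP; split; first exact: measurable_rV_coord.
apply: measurable_fun_rVP => j; rewrite /comp /uncons /=.
by under eq_fun do rewrite mxE; exact: measurable_rV_coord.
Qed.

Let step_sigma_finite : sigma_finite setT lebesgue_rV_step.
Proof.
have /sigma_finiteP[F [TF ndF Foo]] := sigma_finiteT (@lebesgue_measure R).
have /sigma_finiteP[G [TG ndG Goo]] := sigma_finiteT m.
exists (fun i => uncons @^-1` (F i `*` G i)).
  rewrite -preimage_bigcup (_ : \bigcup_i _ = setT) ?preimage_setT//.
  apply/seteqP; split => // -[x y] _.
  have [i _ Fx] : (\bigcup_i F i) x by rewrite -TF.
  have [j _ Gy] : (\bigcup_i G i) y by rewrite -TG.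
  exists (maxn i j) => //; split => /=.
  - by move: x Fx; exact/subsetPset/ndF/leq_maxl.
  - by move: y Gy; exact/subsetPset/ndG/leq_maxr.
move=> i; have [mF Fi] := Foo i; have [mG Gi] := Goo i; split.
  rewrite -[X in measurable X]setTI; apply: measurable_uncons => //.
  exact: measurableX.
rewrite /lebesgue_rV_step /pushforward -comp_preimage.
rewrite (_ : uncons \o _ = id); last by apply/funext => z /=.
by rewrite preimage_id product_measure1E// lte_mul_pinfty// ge0_fin_numE.
Qed.

HB.instance Definition _ := Measure_isSigmaFinite.Build _ _ _ lebesgue_rV_step
  step_sigma_finite.

End step.

(* Lebesgue measure on R^n: the point mass for n = 0, otherwise the product of
   the Lebesgue measure on R and the Lebesgue measure on R^(n-1). *)
Fixpoint lebesgue_rV n : {sigma_finite_measure set 'rV[R]_n -> \bar R} :=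
  match n with
  | 0 => \d_(0 : 'rV[R]_0)
  | n'.+1 => lebesgue_rV_step (lebesgue_rV n')
  end.

Lemma lebesgue_rV_box n (A : 'I_n -> set R) : (forall i, measurable (A i)) ->
  (lebesgue_rV n [set x | forall i, A i (x ord0 i)] =
   \prod_(i < n) lebesgue_measure (A i))%E.
Proof.
elim: n A => [A _|n IH A mA].
  rewrite big_ord0 /= diracE (_ : _ \in _ = true)//.
  by apply/mem_set => -[].
rewrite big_ord_recl -IH; last by move=> i; exact: mA.
have mbox : measurable [set x : 'rV[R]_n | forall i, A (lift ord0 i) (x ord0 i)].
  rewrite [X in measurable X](_ : _ = \bigcap_(i in [set: 'I_n])
    ((fun x : 'rV[R]_n => x ord0 i) @^-1` A (lift ord0 i))).
    apply: fin_bigcap_measurable => // i _.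
    by rewrite -[X in measurable X]setTI; exact: measurable_rV_coord.
  by apply/seteqP; split => [x Ax i _|x Ax i]; exact: Ax.
have := product_measure1E (@lebesgue_measure R) (lebesgue_rV n) (mA ord0) mbox.
move=> <-; rewrite /= /lebesgue_rV_step /pushforward.
congr (_ \x _)%E; apply/seteqP; split => -[x y] /=.
- move=> Axy; split; first by have := Axy ord0; rewrite cons_rV0.
  by move=> i; have := Axy (lift ord0 i); rewrite cons_rVS.
- by case=> Ax Ay i; have [j ->|->] := unliftP ord0 i;
    rewrite ?cons_rVS ?cons_rV0//; exact: Ay.
Qed.

End lebesgue_rV.

Section gaussian_mercer.
Context {R : realType}.

Definition cube d : set 'rV[R]_d :=
  [set x | forall i, 0 <= x ord0 i /\ x ord0 i <= 1].
Arguments cube d _ : clear implicits.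

Definition gaussian_kernel d (sigma : R) (x y : 'rV[R]_d) : R :=
  expR (- sigma * \sum_(i < d) (x ord0 i - y ord0 i) ^+ 2).

(* P, a measure on R^d, is carried by the cube and has density p there; the
   values of p outside the cube play no role. *)
Definition has_density_on_cube d (P : probability 'rV[R]_d R)
    (p : 'rV[R]_d -> R) : Prop :=
  measurable_fun (cube d) p /\
  forall A, measurable A ->
    P A = (\int[lebesgue_rV d]_(z in A `&` cube d) (p z)%:E)%E.

Definition kernel_operator d (p : 'rV[R]_d -> R)
    (k : 'rV[R]_d -> 'rV[R]_d -> R) (f : 'rV[R]_d -> R) (y : 'rV[R]_d) : R :=
  \int[lebesgue_rV d]_(z in cube d) (k z y * f z * p z).

(* Sequences are indexed from 1: mu 0 and phi 0 are ignored.
   mercer_multiplicity says that the phi l with mu l = lambda span the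
   eigenspace of lambda, so that mu lists every nonzero eigenvalue as often as
   its multiplicity. *)
Record mercer_decomposition d (P : probability 'rV[R]_d R) (p : 'rV[R]_d -> R)
    (k : 'rV[R]_d -> 'rV[R]_d -> R)
    (mu : nat -> R) (phi : nat -> 'rV[R]_d -> R) : Prop := {
  mercer_continuous : forall l, (0 < l)%N ->
    {within cube d, continuous (phi l)};
  mercer_orthonormal : forall l m, (0 < l)%N -> (0 < m)%N ->
    (\int[P]_(x in cube d) (phi l x * phi m x)%:E = ((l == m)%:R)%:E)%E;
  mercer_eigen : forall l, (0 < l)%N ->
    {ae P, forall y, kernel_operator p k (phi l) y = mu l * phi l y};
  mercer_nonincreasing : forall l, (0 < l)%N -> mu l.+1 <= mu l;
  mercer_multiplicity : forall (lambda : R) (f : 'rV[R]_d -> R),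
    lambda != 0 -> f \in Lfun P 2%:E ->
    {ae P, forall y, kernel_operator p k f y = lambda * f y} ->
    (forall l, (0 < l)%N -> mu l = lambda ->
      (\int[P]_(x in cube d) (f x * phi l x)%:E = 0)%E) ->
    {ae P, forall y, f y = 0};
  mercer_expansion : forall x y, cube d x -> cube d y ->
    \sum_(1 <= l < n) mu l * phi l x * phi l y @[n --> \oo] --> k x y
}.

Definition c_sigma (d : nat) (sigma : R) : R :=
  Num.max 1 (2 * expR 1 * sigma * d%:R).

(* The library's inf is 0 on sets with no lower bound and its sup is 0 on sets
   with no upper bound; 0 < p_min p thus includes boundedness below, whereas
   p_max p is meaningful only under has_ubound (p @` cube d). *)
Definition p_min d (p : 'rV[R]_d -> R) : R := inf (p @` cube d).
Definition p_max d (p : 'rV[R]_d -> R) : R := sup (p @` cube d).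
Definition c_p d (p : 'rV[R]_d -> R) : R :=
  sup [set (p z)^-1 | z in cube d].

Definition c_0 (d : nat) (sigma cp : R) : R :=
  (ln 3 + (d%:R - 1) * ln 2 + 2^-1 * ln cp
     + d%:R * ln (3 * c_sigma d sigma * d%:R)) / (2 * d%:R * ln 3).

Definition c_1 (d : nat) (sigma cp : R) : R :=
  ((2 * d%:R - 1) * ln 2 + d%:R * ln (3 * c_sigma d sigma) + 2^-1 * ln cp)
    / d%:R + 1.

Definition c_2 (d : nat) (cp : R) : R :=
  ((2 * d%:R - 1) * ln 2 + 2^-1 * ln cp) / d%:R.

Definition c_max (d : nat) (sigma cp : R) : R :=
  Num.max (Num.max (Num.max (c_0 d sigma cp) (c_1 d sigma cp)) (c_2 d cp)) 1.

(* C and c stand for C(d,sigma) and c_{d,sigma}. *)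
Definition h_bound d (sigma : R) (p : 'rV[R]_d -> R) (C c : R) (l : nat) : R :=
  (3 * c_sigma d sigma *
     Num.max (2^-1 * ln 9 - 2^-1 * ln (p_min p ^+ 2 / p_max p ^+ 2 * C)
              + 2^-1 * c * (l + d)%:R `^ (2 / d%:R)) 0
   + 2) ^+ d.

End gaussian_mercer.
Arguments cube {R} d _.

(* Main.v *)
Require Import Defs.
Set Warnings "-all".
From mathcomp Require Import all_boot all_order all_algebra.
From mathcomp Require Import all_classical all_reals all_analysis.
From mathcomp Require Import measurable_realfun ring lra zify.

(** The eigenfunction equation [lambda phi = L_k phi] expresses [phi] through the
kernel, and truncating the exponential series of the Gaussian after [m] terms
replaces [L_k phi] by a function [Q] that is polynomial of degree at most
[2 m - 2] in each coordinate. If the truncation error is at most [lambda], then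
[|lambda phi - Q| <= lambda] on the cube: almost everywhere at first, hence
everywhere by continuity, the density being bounded below. So [|Q|] has
[L^2(P)]-norm at most [2 lambda] and Lebesgue [L^2]-norm at most
[2 lambda sqrt c_p].

A polynomial of degree [n] on [[0, 1]] satisfies [|q(x)| <= (n + 1) ||q||_2]:
at the endpoint [0] by Cauchy-Schwarz against the kernel reproducing [q(0)],
whose squared norm is [(n + 1)^2], and at an interior point [x] by splitting the
interval at [x]. Tensorizing, [|Q| <= (2 m - 1)^d * 2 lambda sqrt c_p].
Finally, if [exp (- 2 t) <= lambda] and [t >= e], the choice [m ~ 3 c_sigma t / 2]
makes the truncation error at most [lambda]. *)

Set Implicit Arguments.
Unset Strict Implicit.
Unset Printing Implicit Defensive.

Import Order.TTheory GRing.Theory Num.Theory.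
Import numFieldNormedType.Exports.

Local Open Scope ring_scope.

(** * A sharp Nikolskii inequality for polynomials *)

Section endpoint_inequality.
Context {F : numFieldType}.
Implicit Types (p q : {poly F}) (n : nat).

(** The [n]-th finite difference kills degree below [n]. Write [q = q' * X + c]: the constant
    contributes a multiple of [(1 - 1)^n], and [k * 'C(n, k) = n * 'C(n.-1, k.-1)] turns the rest
    into the same sum at order [n - 1] for the shifted polynomial [q'(X + 1)]. *)
Lemma alternating_binomial_sum n q : (size q <= n)%N ->
  \sum_(k < n.+1) (-1) ^+ k * 'C(n, k)%:R * q.[k%:R] = 0.
Proof.
elim: n q => [|n IH] q.
  by rewrite leqn0 size_poly_eq0 => /eqP->; rewrite big_ord1 horner0 mulr0.
elim/poly_ind: q => [|q c _].
  by move=> _; rewrite big1// => k _; rewrite horner0 mulr0.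
rewrite size_MXaddC => sq.
have {}sq : (size q <= n)%N.
  by move: sq; case: ifP => // /andP[/eqP-> _]; rewrite size_poly0.
under eq_bigr do rewrite hornerMXaddC mulrDr.
rewrite big_split/= -mulr_suml.
have -> : \sum_(k < n.+2) (-1) ^+ k * 'C(n.+1, k)%:R = (1 - 1) ^+ n.+1 :> F.
  rewrite exprBn; apply: eq_bigr => k _.
  by rewrite !expr1n !mulr1 mulr_natr.
rewrite subrr expr0n/= mul0r addr0 big_ord_recl/= mulr0n !mulr0 add0r.
transitivity (- n.+1%:R *
    \sum_(k < n.+1) (-1) ^+ k * 'C(n, k)%:R * (q \Po ('X + 1%:P)).[k%:R]).
  rewrite mulr_sumr; apply: eq_bigr => k _.
  rewrite /bump leq0n add1n horner_comp hornerD hornerX hornerC natr1 exprS.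
  have := congr1 (fun m : nat => m%:R : F) (mul_bin_diag n.+1 k); rewrite !natrM/=.
  move: (q.[_]) ('C(n.+1, k.+1)%:R : F) (n.+1%:R : F) => x y u e.
  transitivity (- (-1) ^+ k * x * (k.+1%:R * y)); first by rewrite -natr1; ring.
  by rewrite -e; ring.
rewrite IH ?mulr0// size_comp_poly2// size_XaddC//.
Qed.

(** The integral over [[0, 1]] in algebraic form, so that the kernel identities hold over any
    [numFieldType]; [integral01_horner] identifies it with the Lebesgue integral over the reals. *)
Definition poly_int q : F := \sum_(i < size q) q`_i / i.+1%:R.

Lemma poly_intE n q : (size q <= n)%N ->
  poly_int q = \sum_(i < n) q`_i / i.+1%:R.
Proof.
move=> sq; rewrite /poly_int (big_ord_widen _ (fun i => q`_i / i.+1%:R) sq).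
rewrite big_mkcond/=; apply: eq_bigr => i _; case: ltnP => // qi.
by rewrite nth_default// mul0r.
Qed.

Lemma poly_intD p q : poly_int (p + q) = poly_int p + poly_int q.
Proof.
pose n := maxn (size p) (size q).
rewrite !(@poly_intE n) ?size_polyD// ?leq_maxl ?leq_maxr//.
by rewrite -big_split/=; apply: eq_bigr => i _; rewrite coefD mulrDl.
Qed.

Lemma poly_intZ a q : poly_int (a *: q) = a * poly_int q.
Proof.
rewrite (@poly_intE (size q)) ?size_scale_leq// mulr_sumr.
by apply: eq_bigr => i _; rewrite coefZ mulrA.
Qed.

Lemma poly_int_sum I (r : seq I) (f : I -> {poly F}) :
  poly_int (\sum_(i <- r) f i) = \sum_(i <- r) poly_int (f i).
Proof.
apply: (big_morph poly_int poly_intD).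
by rewrite /poly_int size_poly0 big_ord0.
Qed.

Lemma poly_intXn n : poly_int 'X^n = n.+1%:R^-1.
Proof.
rewrite /poly_int size_polyXn big_ord_recr/= coefXn eqxx mul1r big1 ?add0r// => i _.
by rewrite coefXn ltn_eqF ?ltn_ord// mul0r.
Qed.

Lemma poly_int_deriv q : poly_int q^`() = q.[1] - q.[0].
Proof.
elim/poly_ind: q => [|q c _].
  by rewrite deriv0 /poly_int size_poly0 big_ord0 !horner0 subrr.
rewrite derivD derivC addr0 !hornerMXaddC mulr1 mulr0 add0r addrK.
rewrite (@poly_intE (size q)); last first.
  apply/leq_sizeP => j qj; rewrite coef_deriv coefMX/= nth_default ?mul0rn//.
rewrite horner_coef; apply: eq_bigr => i _.
rewrite coef_deriv coefMX/= expr1n mulr1 -[q`_i *+ _]mulr_natr mulfK// pnatr_eq0//.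
Qed.

Lemma poly_primitive q : exists A : {poly F}, A^`() = q.
Proof.
exists (\poly_(i < (size q).+1) (q`_i.-1 / i%:R)).
apply/polyP => i; rewrite coef_deriv coef_poly /= ltnS -[_ *+ _]mulr_natr.
case: ltnP => qi; first by rewrite mulfVK// pnatr_eq0.
by rewrite nth_default// mul0r.
Qed.

Lemma poly_int_coefMXn n p j : (size p <= n)%N ->
  poly_int ('X^j * p) = \sum_(k < n) p`_k / (k + j).+1%:R.
Proof.
move=> sp; rewrite {1}(_ : p = \sum_(k < n) p`_k *: 'X^k); last first.
  rewrite -poly_def; apply/polyP => k; rewrite coef_poly; case: ltnP => // nk.
  by rewrite nth_default// (leq_trans sp).
rewrite mulr_sumr poly_int_sum; apply: eq_bigr => k _.
by rewrite -scalerAr poly_intZ -exprD poly_intXn addnC.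
Qed.

(* The kernel reproducing [q |-> q.[0]] on degree [<= n] is a multiple of
   [sum_k (- 1)^k 'C(n, k) W(k) X^k], [W = prod_(i < n) (X + i + 2)]: division of
   [W(k)] by [k + j + 1], [1 <= j <= n], leaves a polynomial of degree [< n], which
   is killed by the [n]-th finite difference. *)
Let weight n : {poly F} := \prod_(i < n) ('X + i.+2%:R%:P).

Definition endpoint_kernel n : {poly F} :=
  \poly_(k < n.+1) ((-1) ^+ k * 'C(n, k)%:R * (weight n).[k%:R]).

Lemma endpoint_kernel0 n : (endpoint_kernel n).[0] = n.+1%:R * n`!%:R.
Proof.
rewrite horner_coef0 coef_poly/= expr0 bin0 !mul1r /weight horner_prod.
rewrite -natrM -factS; elim: n => [|n IH]; first by rewrite big_ord0.
by rewrite big_ord_recr/= IH hornerD hornerX hornerC add0r [in RHS]factS -natrM mulnC.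
Qed.

(** Here the division is by [k + 1], with remainder [W(-1) = n!]: the quotient [v] has degree below
    [n] and is killed by the finite difference, while the remainder leaves [n!] times the integral
    of [(1 - X)^n], which is [1 / (n + 1)]. *)
Lemma poly_int_endpoint_kernel n :
  poly_int (endpoint_kernel n) = n`!%:R / n.+1%:R.
Proof.
have := @poly_int_coefMXn n.+1 (endpoint_kernel n) 0 (size_poly _ _).
rewrite expr0 mul1r => ->.
have : root (weight n - n`!%:R%:P) (-1).
  rewrite /root !hornerE /weight horner_prod subr_eq0; apply/eqP.
  elim: n => [|n IH]; first by rewrite big_ord0.
  by rewrite big_ord_recr/= IH hornerD hornerX hornerC factS natrM; ring.
move=> /factor_theorem[v vE].
have sv : (size v <= n)%N.
  have [->|v0] := eqVneq v 0; first by rewrite size_poly0.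
  have : (size (weight n - n`!%:R%:P)%R <= n.+1)%N.
    rewrite (leq_trans (size_polyD _ _))// geq_max size_polyN.
    rewrite (leq_trans (size_polyC_leq1 _))// andbT.
    rewrite (leq_trans (size_prod_leq _ _))//.
    under eq_bigr do rewrite size_XaddC.
    by rewrite sum_nat_const card_ord; lia.
  by rewrite vE size_Mmonic ?monicXsubC// size_XsubC addn2.
transitivity (\sum_(k < n.+1) (-1) ^+ k * 'C(n, k)%:R * v.[k%:R] +
    n`!%:R * \sum_(k < n.+1) (-1) ^+ k * 'C(n, k)%:R / k.+1%:R).
  rewrite mulr_sumr -big_split/=; apply: eq_bigr => k _.
  rewrite coef_poly ltn_ord addn0.
  have -> : (weight n).[k%:R] = v.[k%:R] * k.+1%:R + n`!%:R.
    have := congr1 (horner^~ k%:R) vE; rewrite !hornerE/= opprK natr1 => <-.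
    by rewrite subrK.
  rewrite mulrDr mulrDl !mulrA mulfK ?pnatr_eq0//.
  by congr (_ + _); ring.
rewrite alternating_binomial_sum// add0r; congr (_ * _).
have -> : \sum_(k < n.+1) (-1) ^+ k * 'C(n, k)%:R / k.+1%:R =
    poly_int ((1 - 'X) ^+ n) :> F.
  rewrite exprBn poly_int_sum; apply: eq_bigr => k _.
  rewrite (_ : _ *+ _ = ((-1) ^+ k * 'C(n, k)%:R) *: 'X^k).
    by rewrite poly_intZ poly_intXn.
  rewrite expr1n mulr1 -mul_polyC rmorphM rmorphXn rmorphN1 rmorph_nat/=.
  by rewrite mulrAC mulr_natr.
have d1 : (1 - 'X : {poly F})^`() = -1.
  by rewrite derivB derivX -polyC1 derivC sub0r.
have := poly_int_deriv ((1 - 'X : {poly F}) ^+ n.+1).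
rewrite deriv_exp d1 /= mulN1r !horner_exp hornerD hornerN hornerX hornerC.
rewrite subrr !hornerD !hornerN !hornerX !hornerC subr0 expr1n expr0n/= sub0r.
rewrite mulNrn -scaler_nat -scaleN1r !poly_intZ mulN1r => /oppr_inj e.
by rewrite -[LHS](mulKf (_ : n.+1%:R != 0)) ?e ?mulr1// pnatr_eq0.
Qed.

Lemma poly_int_mul_endpoint_kernel n q : (size q <= n.+1)%N ->
  poly_int (q * endpoint_kernel n) = q.[0] * poly_int (endpoint_kernel n).
Proof.
move=> sq.
have qE : q = \sum_(j < n.+1) q`_j *: 'X^j.
  rewrite -poly_def; apply/polyP => j; rewrite coef_poly; case: ltnP => // nj.
  by rewrite nth_default// (leq_trans sq).
rewrite {1}qE mulr_suml poly_int_sum big_ord_recl big1 ?addr0.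
  by rewrite horner_coef0 -scalerAl poly_intZ expr0 mul1r.
move=> j _; rewrite -scalerAl poly_intZ.
rewrite (@poly_int_coefMXn n.+1) ?size_poly//.
apply/eqP; rewrite mulf_eq0; apply/orP; right; apply/eqP.
(* After [big_ord_recl] the monomial is [X^(j + 1)], so the coefficient is divided by [k + j + 2],
   exactly the factor of index [j] of the weight at [k]. Without it the degree is [n - 1]. *)
pose v := \prod_(i < n | i != j) ('X + i.+2%:R%:P) : {poly F}.
rewrite -[RHS](@alternating_binomial_sum n v); last first.
  rewrite (leq_trans (size_prod_leq _ _))//.
  under eq_bigr do rewrite size_XaddC.
  rewrite sum_nat_const -cardsE.
  have := cardsC1 j; rewrite card_ord.
  rewrite (_ : [set~ j] = [set x | x != j]); last by apply/setP => x; rewrite !inE.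
  by rewrite cardsE; have := ltn_ord j; lia.
apply: eq_bigr => k _; rewrite coef_poly ltn_ord /weight (bigD1 j)//= -/v.
rewrite hornerM hornerD hornerX hornerC -natrD /bump leq0n add1n !addnS.
have : (k + j).+2%:R != 0 :> F by rewrite pnatr_eq0.
by move: (_.+2%:R) (_ * 'C(_, _)%:R) => u s u0; rewrite -mulrA mulrAC mulfV ?mul1r.
Qed.

End endpoint_inequality.

Section nikolskii_poly.
Context {F : realFieldType}.
Hypothesis poly_int_sqr_ge0 : forall q : {poly F}, 0 <= poly_int (q ^+ 2).
Implicit Types (p q : {poly F}) (n : nat).

(** Cauchy-Schwarz in expanded form: integrate [(q - a r)^2 >= 0], with [a] chosen so that [q - a r]
    vanishes at [0]. Both cross terms reduce to [poly_int r] by the reproducing property, and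
    [r(0) = (n + 1)^2 * poly_int r] supplies the constant. *)
Lemma endpoint_inequality n q : (size q <= n.+1)%N ->
  q.[0] ^+ 2 <= n.+1%:R ^+ 2 * poly_int (q ^+ 2).
Proof.
move=> sq; pose r : {poly F} := endpoint_kernel n; pose a := q.[0] / r.[0].
have r0 : 0 < r.[0] by rewrite /r endpoint_kernel0 mulr_gt0// ltr0n// fact_gt0.
have ratio : r.[0] = n.+1%:R ^+ 2 * poly_int r.
  rewrite /r endpoint_kernel0 poly_int_endpoint_kernel.
  have : n.+1%:R != 0 :> F by rewrite pnatr_eq0.
  by move: (n.+1%:R) => u u0; field.
have := poly_int_sqr_ge0 (q - a *: r).
rewrite (_ : _ ^+ 2 = q ^+ 2 + ((- a - a) *: (q * r) + a ^+ 2 *: (r * r))); last first.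
  by rewrite -!mul_polyC rmorphXn rmorphB rmorphN/=; ring.
rewrite !poly_intD !poly_intZ.
rewrite !poly_int_mul_endpoint_kernel ?size_poly// -/r => ge0.
have q0E : q.[0] = a * r.[0] by rewrite /a mulfVK// gt_eqF.
rewrite q0E in ge0 *.
have : 0 <= n.+1%:R ^+ 2 * (poly_int (q ^+ 2) - a ^+ 2 * (r.[0] * poly_int r)).
  by apply: mulr_ge0; [exact: sqr_ge0|lra].
rewrite mulrBr subr_ge0; apply: le_trans.
rewrite le_eqVlt; apply/orP; left; apply/eqP.
transitivity (a ^+ 2 * r.[0] * r.[0]); first by ring.
by rewrite {2}ratio; ring.
Qed.

(* Both [0, x] and [x, 1] have [x] as an endpoint; averaging the endpoint
   inequalities on them with weights [x] and [1 - x] loses nothing. *)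
Lemma poly_nikolskii n q x : (size q <= n.+1)%N -> 0 <= x -> x <= 1 ->
  q.[x] ^+ 2 <= n.+1%:R ^+ 2 * poly_int (q ^+ 2).
Proof.
move=> sq x0 x1.
have [A AE] := poly_primitive (q ^+ 2).
(* [A] is a primitive of [q^2]. The values [a = - x] and [a = 1 - x] map [[0, 1]] onto the two
   pieces, and their integrals telescope to [A(1) - A(0)]. *)
have int_affine a : a * poly_int ((q \Po (x%:P + a *: 'X)) ^+ 2) = A.[x + a] - A.[x].
  have := poly_int_deriv (A \Po (x%:P + a *: 'X)).
  rewrite deriv_comp AE !horner_comp derivD derivC derivZ derivX add0r.
  rewrite comp_polyM -expr2 -scalerAr mulr1 poly_intZ.
  by rewrite !hornerD !hornerC !hornerZ !hornerX mulr1 mulr0 addr0.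
have endpoint a : q.[x] ^+ 2 <= n.+1%:R ^+ 2 * poly_int ((q \Po (x%:P + a *: 'X)) ^+ 2).
  have := @endpoint_inequality n (q \Po (x%:P + a *: 'X)).
  rewrite horner_comp hornerD hornerC hornerZ hornerX mulr0 addr0; apply.
  have [->|a0] := eqVneq a 0.
    by rewrite scale0r addr0 comp_polyCr (leq_trans (size_polyC_leq1 _)).
  rewrite size_comp_poly2// addrC size_addl size_scale// ?size_polyX//.
  by rewrite (leq_ltn_trans (size_polyC_leq1 _)).
have -> : poly_int (q ^+ 2) = A.[1] - A.[0] by rewrite -AE poly_int_deriv.
have := int_affine (1 - x); have := int_affine (- x).
rewrite subrr (addrC x) subrK => e0 e1.
have := lerD (ler_wpM2l x0 (endpoint (- x)))
  (ler_wpM2l (_ : 0 <= 1 - x) (endpoint (1 - x))).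
rewrite subr_ge0 => /(_ x1).
rewrite !(mulrCA _ (n.+1%:R ^+ 2)) e1 -[x in x * poly_int _]opprK mulNr e0.
rewrite -mulrDl addrC subrK mul1r -mulrDr => /le_trans; apply.
by rewrite le_eqVlt; apply/orP; left; apply/eqP; ring.
Qed.

End nikolskii_poly.

Local Open Scope classical_set_scope.
Local Open Scope ring_scope.

(** * Tail of the exponential series *)

Section exp_tail.
Context {R : realType}.
Implicit Types w a : R.

Definition exp_trunc (m : nat) w : R := \sum_(j < m) w ^+ j / j`!%:R.

Lemma exp_coeff_le_expR w m : 0 <= w -> \sum_(0 <= j < m) w ^+ j / j`!%:R <= expR w.
Proof.
move=> w0; have := @is_cvg_series_exp_coeff R w => cw.
apply: (@nondecreasing_cvgn_le _ (series (exp_coeff w))) => //.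
by apply/nondecreasing_seqP => n; rewrite seriesEnat/= big_nat_recr//= lerDl exp_coeff_ge0.
Qed.

(* Rankin's trick: for [j >= m], [w ^ j <= a ^ (- m) * (a w) ^ j]. *)
Lemma exp_trunc_error m w a : 0 <= w -> 1 <= a ->
  `|expR (- w) - exp_trunc m (- w)| <= a ^- m * expR (a * w).
Proof.
move=> w0 a1; have a0 : 0 < a by apply: lt_le_trans a1.
have cw := @is_cvg_series_exp_coeff R (- w).
have cvgn : `|series (exp_coeff (- w)) n - exp_trunc m (- w)| @[n --> \oo] -->
    `|expR (- w) - exp_trunc m (- w)|.
  by apply: cvg_norm; apply: cvgB => //; exact: cvg_cst.
rewrite -(cvg_lim (@Rhausdorff R) cvgn).
apply: limr_le; first by apply/cvg_ex; eexists; exact: cvgn.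
near=> n.
have mn : (m <= n)%N by near: n; exact: nbhs_infty_ge.
rewrite seriesEnat /exp_coeff/= /exp_trunc -(big_mkord xpredT (fun j => (- w) ^+ j / j`!%:R)).
rewrite (@big_cat_nat _ _ _ m)//= [X in `|X|]addrC.
rewrite addKr.
apply: (le_trans (ler_norm_sum _ _ _)).
apply: (@le_trans _ _ (a ^- m * \sum_(m <= j < n) (a * w) ^+ j / j`!%:R)).
  rewrite mulr_sumr; apply: ler_sum_nat => j /andP[mj _].
  rewrite normrM normrX normrN (ger0_norm w0) ger0_norm ?invr_ge0//.
  rewrite mulrA ler_wpM2r ?invr_ge0// exprMn mulrA ler_peMl ?exprn_ge0//.
  by rewrite mulrC ler_pdivlMr ?exprn_gt0// mul1r ler_weXn2l.
rewrite ler_wpM2l ?invr_ge0 ?exprn_ge0 ?(ltW a0)//.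
apply: le_trans (exp_coeff_le_expR n (mulr_ge0 (ltW a0) w0)).
rewrite (@big_cat_nat _ _ _ m 0 n)//= lerDr sumr_ge0// => j _.
by rewrite divr_ge0// exprn_ge0// mulr_ge0// ltW.
Unshelve. all: by end_near. Qed.

End exp_tail.

(** * Polynomial integrals as Lebesgue integrals *)

Section polynomial_integral.
Context {R : realType}.
Implicit Types q : {poly R}.
Local Notation leb := (@lebesgue_measure R).

Lemma integral01_horner q :
  (\int[leb]_(s in `[0%R, 1%R]) (q.[s])%:E = (poly_int q)%:E)%E.
Proof.
have [A AE] := poly_primitive q.
rewrite (@continuous_FTC2 R (horner q) (horner A) 0 1)//.
- by rewrite -AE poly_int_deriv.
- by apply: continuous_subspaceT => x; exact: continuous_horner.
- split.
  + by move=> x _; exact: derivable_horner.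
  + by apply: cvg_at_right_filter; exact: continuous_horner.
  + by apply: cvg_at_left_filter; exact: continuous_horner.
- by move=> x _; rewrite -derivE AE.
Qed.

Lemma poly_int_sqr_ge0 q : 0 <= poly_int (q ^+ 2).
Proof.
rewrite -lee_fin -integral01_horner integral_ge0// => s _.
by rewrite lee_fin horner_exp sqr_ge0.
Qed.

End polynomial_integral.

(** * Measure on the cube *)

Section measurability_rV.
Context {R : realType}.

Lemma ball_rVE n (x : 'rV[R]_n) e : 0 < e ->
  ball x e = [set y | forall i, ball (x ord0 i) e (y ord0 i)].
Proof.
move=> e0; apply/seteqP; split => y /=; first by case=> _ + i; exact.
by move=> xy; split=> // i j; rewrite ord1.
Qed.

Lemma measurable_box_rV n (A : 'I_n -> set R) : (forall i, measurable (A i)) ->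
  measurable [set x : 'rV[R]_n | forall i, A i (x ord0 i)].
Proof.
move=> mA; rewrite [X in measurable X](_ : _ = \bigcap_(i in [set: 'I_n])
    ((fun x : 'rV[R]_n => x ord0 i) @^-1` A i)).
  apply: fin_bigcap_measurable => // i _.
  by rewrite -[X in measurable X]setTI; exact: measurable_rV_coord.
by apply/seteqP; split => [x Ax i _|x Ax i]; exact: Ax.
Qed.

Lemma cubeE n : cube n = [set x : 'rV[R]_n | forall i, `[0, 1]%classic (x ord0 i)].
Proof.
by apply/seteqP; split => x xc i; have /= := xc i; rewrite in_itv/= => /andP.
Qed.

Lemma measurable_cube n : measurable (@cube R n).
Proof. by rewrite cubeE; exact: (measurable_box_rV (fun=> measurable_itv _)). Qed.

Lemma compact_cube n : compact (@cube R n).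
Proof.
rewrite cubeE; apply: (@rV_compact R n (fun=> `[0, 1]%classic)) => i.
exact: segment_compact.
Qed.

(** Balls of ['rV[R]_n] are boxes, hence measurable for the sigma-algebra generated by the
    coordinates, and an open set is a countable union of balls with rational centre and radius
    [1 / (k + 1)]. *)
Lemma open_measurable_rV n (A : set 'rV[R]_n) : open A -> measurable A.
Proof.
move=> oA; pose c (q : 'rV[rat]_n) : 'rV[R]_n := map_mx ratr q.
pose B (u : 'rV[rat]_n * nat) : set 'rV[R]_n :=
  if `[< ball (c u.1) u.2.+1%:R^-1 `<=` A >] then ball (c u.1) u.2.+1%:R^-1 else set0.
rewrite (_ : A = \bigcup_u B u).
  apply: countable_bigcupT_measurable => // u; rewrite /B; case: ifP => // _.
  rewrite ball_rVE//; apply: (measurable_box_rV (A := fun i => ball (c u.1 ord0 i) _)) => i.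
  by apply: open_measurable; exact: ball_open.
apply/seteqP; split => [x Ax|x [u _]]; last first.
  by rewrite /B; case: asboolP => //; exact.
have /nbhs_ballP[e /= e0 eA] := open_nbhs_nbhs (conj oA Ax).
(* A radius below [e / 2] keeps every ball containing [x] within distance [e] of [x]. *)
have [k ke] : exists k : nat, k.+1%:R^-1 < e / 2.
  have [k _ /(_ k (leqnn k))/= ke] := near_infty_natSinv_lt (PosNum (divr_gt0 e0 (ltr0n R 2))).
  by exists k.
have k0 : 0 < k.+1%:R^-1 :> R by rewrite invr_gt0.
set r0 : R := k.+1%:R^-1 in ke k0.
have [q qx] : exists q : 'rV[rat]_n, ball (c q) r0 x.
  have /choice[f fP] : forall i : 'I_n, exists r : rat, ball (ratr r : R) r0 (x ord0 i).
    move=> i; have : x ord0 i - r0 < x ord0 i + r0 by lra.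
    move=> /rat_in_itvoo[r]; rewrite in_itv/= => /andP[r1 r2]; exists r.
    by rewrite /ball/= ltr_norml; apply/andP; split; lra.
  by exists (\row_i f i); rewrite ball_rVE// => i /=; rewrite !mxE.
exists (q, k) => //; rewrite /B /=; case: asboolP => // -[] y qy; apply: eA.
apply: (@le_ball _ _ _ (r0 + r0)); first by lra.
exact: ball_triangle (ball_sym qx) qy.
Qed.

Lemma within_continuous_measurable_rV n (D : set 'rV[R]_n) (f : 'rV[R]_n -> R) :
  measurable D -> {within D, continuous f} -> measurable_fun D f.
Proof.
move=> mD /continuousP cf; apply: (measurability _ (RGenOpens.measurableE R)).
move=> _ [_ [a [b ->] <-]].
have : open (f @^-1` `]a, b[ : set (subspace D)) by exact/cf/interval_open.
move=> /open_subspaceP[U oU UE].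
rewrite setIC -UE; apply: measurableI => //; exact: open_measurable_rV.
Qed.

(** The intersection contains the box of half-width [e / 2] around [x] clipped to [[0, 1]], whose
    sides have positive length even when [x] lies on the boundary. *)
Lemma lebesgue_rV_ball_cube n (x : 'rV[R]_n) e : 0 < e -> cube n x ->
  (0 < lebesgue_rV n (ball x e `&` cube n))%E.
Proof.
move=> e0 xc.
pose A (i : 'I_n) := [set` `[Num.max 0 (x ord0 i - e / 2), Num.min 1 (x ord0 i + e / 2)]].
apply: (@lt_le_trans _ _ (lebesgue_rV n [set y | forall i, A i (y ord0 i)])).
  rewrite lebesgue_rV_box; last by move=> i; exact: measurable_itv.
  elim/big_ind : _ => // [u v u0 v0|i _]; first exact: mule_gt0.
  rewrite lebesgue_measure_itv/= lte_fin; have [? ?] := xc i.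
  have -> : Num.max 0 (x ord0 i - e / 2) < Num.min 1 (x ord0 i + e / 2).
    rewrite gt_max !lt_min; apply/andP; split; apply/andP; split; lra.
  rewrite -EFinB lte_fin subr_gt0.
  rewrite gt_max !lt_min; apply/andP; split; apply/andP; split; lra.
apply: le_measure; rewrite ?inE.
- by apply: (measurable_box_rV (A := A)) => i; exact: measurable_itv.
- apply: measurableI; last exact: measurable_cube.
  by apply: open_measurable_rV; exact: ball_open.
- move=> y Ay; split.
    rewrite ball_rVE// => i /=; have := Ay i; rewrite /A/= in_itv/= ge_max le_min.
    by move=> /andP[/andP[? ?] /andP[? ?]]; rewrite /ball/= ltr_norml; lra.
  move=> i; have := Ay i; rewrite /A/= in_itv/= ge_max le_min.
  by move=> /andP[/andP[? ?] /andP[? ?]].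
Qed.

End measurability_rV.

(** * The Nikolskii inequality on the cube *)

Section nikolskii.
Context {R : realType}.
Local Notation leb := (@lebesgue_measure R).

(** Degree at most [n] in each variable separately, tested on lines parallel to the axes: this is
    all that an induction on the dimension consumes. *)
Definition coordwise_poly (d n : nat) (g : 'rV[R]_d -> R) : Prop :=
  forall (x : 'rV[R]_d) (i : 'I_d), exists2 q : {poly R}, (size q <= n.+1)%N &
    forall s, g (\row_j if j == i then s else x ord0 j) = q.[s].

Local Open Scope ereal_scope.

Lemma integral_lebesgue_rVS d (f : 'rV[R]_d.+1 -> \bar R) :
  measurable_fun setT f -> (forall x, 0 <= f x) ->
  \int[lebesgue_rV d.+1]_x f x =
  \int[leb]_s \int[lebesgue_rV d]_y f (cons_rV (s, y)).
Proof.
move=> mf f0.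
have := @ge0_integral_pushforward _ _ (measurableTypeR R * 'rV[R]_d)%type _ R _
  (@measurable_cons_rV R d) (leb \x lebesgue_rV d) setT f measurableT mf (fun x _ => f0 x).
rewrite preimage_setT => ->.
have mc := @measurable_cons_rV R d.
rewrite fubini_tonelli1//; first exact: (measurableT_comp mf mc).
by move=> z; exact: f0.
Qed.

Lemma cube_cons_rV d (s : R) (y : 'rV[R]_d) :
  cube d.+1 (cons_rV (s, y)) <-> (0 <= s <= 1)%R /\ cube d y.
Proof.
split=> [c|[/andP[s0 s1] c] i].
  split; first by have := c ord0; rewrite cons_rV0/= => -[-> ->].
  by move=> i; have := c (lift ord0 i); rewrite cons_rVS.
by have [j ->|->] := unliftP ord0 i; rewrite ?cons_rVS ?cons_rV0//; exact: c.
Qed.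

Lemma integral_cubeS d (f : 'rV[R]_d.+1 -> \bar R) :
  measurable_fun (cube d.+1) f -> (forall x, 0 <= f x) ->
  \int[lebesgue_rV d.+1]_(x in cube d.+1) f x =
  \int[leb]_(s in `[0%R, 1%R]) \int[lebesgue_rV d]_(y in cube d) f (cons_rV (s, y)).
Proof.
move=> mf f0; rewrite integral_mkcond integral_lebesgue_rVS; last 2 first.
- by apply/(measurable_restrictT _ _).1 => //; exact: measurable_cube.
- by move=> x; rewrite patchE; case: ifP.
rewrite [RHS]integral_mkcond; apply: eq_integral => s _; rewrite patchE.
case: ifPn => [|/negP] s01.
  rewrite [RHS]integral_mkcond; apply: eq_integral => y _; rewrite !patchE.
  move: s01; rewrite inE/= in_itv/= => s01.
  congr (if _ then _ else _); apply/idP/idP; rewrite !inE.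
    by move=> /cube_cons_rV[].
  by move=> c; apply/cube_cons_rV.
rewrite integral0_eq// => y _; rewrite patchE; case: ifPn => //; rewrite inE.
by move=> /cube_cons_rV[s01' _]; exfalso; apply: s01; rewrite inE/= in_itv.
Qed.

(** Induction on [d]: the one-variable inequality along the first coordinate bounds [g x ^+ 2] by an
    integral over [s], the induction hypothesis bounds the integrand for each fixed [s], and Tonelli
    reassembles the cube. Each coordinate costs a factor [(n + 1)^2]. *)
Lemma coordwise_poly_nikolskii d n (g : 'rV[R]_d -> R) :
  measurable_fun setT g -> coordwise_poly n g -> forall x, cube d x ->
  ((g x ^+ 2)%R)%:E <= ((n.+1%:R ^+ 2) ^+ d)%:E *
    \int[lebesgue_rV d]_(z in cube d) ((g z) ^+ 2)%:E.
Proof.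
elim: d g => [|d IH] g mg pg x xc.
  have x0 (y : 'rV[R]_0) : y = 0%R by apply/rowP => -[].
  rewrite expr0 mul1e integral_dirac; last first.
  - apply/measurable_EFinP; apply: measurable_funX; exact: measurable_funTS.
  - exact: measurable_cube.
  by rewrite diracE mem_set ?mul1e ?(x0 x)// => -[].
pose y : 'rV[R]_d := \row_j x ord0 (lift ord0 j).
have xE : x = cons_rV (x ord0 ord0, y).
  apply/rowP => i; have [j ->|->] := unliftP ord0 i.
    by rewrite cons_rVS mxE.
  by rewrite cons_rV0.
have yc : cube d y by move=> i; rewrite mxE; exact: xc.
have sec s : coordwise_poly n (fun z => g (cons_rV (s, z))).
  move=> z i; have [q sq qE] := pg (cons_rV (s, z)) (lift ord0 i).
  exists q => // t; rewrite -qE; congr g; apply/rowP => k.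
  have [j ->|->] := unliftP ord0 k.
    by rewrite [RHS]mxE !cons_rVS (inj_eq (@lift_inj _ _)) mxE.
  by rewrite [RHS]mxE !cons_rV0 /=.
have msec s : measurable_fun setT (fun z => g (cons_rV (s, z))).
  have mc : measurable_fun setT (@cons_rV R d \o pair s).
    exact: measurableT_comp (@measurable_cons_rV R d) (pair1_measurable s).
  exact: (measurableT_comp mg mc).
have [q sq qE] : exists2 q : {poly R}, (size q <= n.+1)%N &
    forall s, g (cons_rV (s, y)) = q.[s].
  have [q sq qE] := pg (cons_rV (0%R, y)) ord0; exists q => // s.
  rewrite -qE; congr g; apply/rowP => k; rewrite [RHS]mxE.
  have [j ->|->] := unliftP ord0 k; first by rewrite !cons_rVS.
  by rewrite eqxx cons_rV0.
have [x0 x1] := xc ord0.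
rewrite xE qE; apply: (@le_trans _ _ ((n.+1%:R ^+ 2)%:E * (poly_int (q ^+ 2))%:E)).
  by rewrite -EFinM lee_fin poly_nikolskii//; exact: poly_int_sqr_ge0.
rewrite -integral01_horner [(_ ^+ d.+1)%R]exprS EFinM -muleA lee_wpmul2l ?lee_fin ?sqr_ge0//.
rewrite integral_cubeS; last 2 first.
- by apply/measurable_EFinP; apply: measurable_funX; exact: measurable_funTS.
- by move=> z; rewrite lee_fin sqr_ge0.
have mc := @measurable_cons_rV R d.
have mF : measurable_fun setT
    (fun s => \int[lebesgue_rV d]_(z in cube d) (g (cons_rV (s, z)) ^+ 2)%:E).
  under eq_fun do rewrite integral_mkcond.
  (* The restriction to the cube becomes an indicator factor, so that Tonelli's measurability
     statement applies on the whole product space. *)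
  pose h (u : R * 'rV[R]_d) : \bar R := ((g (cons_rV u) ^+ 2)%:E * (\1_(cube d) u.2)%:E).
  have := @measurable_fun_fubini_tonelli_F _ _ _ _ R (lebesgue_rV d) h.
  move=> H; have : measurable_fun setT (fubini_F (lebesgue_rV d) h).
    apply: H.
    - apply: emeasurable_funM; apply/measurable_EFinP.
        by apply: measurable_funX; exact: (measurableT_comp mg mc).
      have m1 : measurable_fun setT (\1_(cube d) : 'rV[R]_d -> R).
        by apply: measurable_indic; exact: measurable_cube.
      exact: (measurableT_comp m1 (@measurable_snd _ _ (measurableTypeR R) 'rV[R]_d)).
    - by move=> u; rewrite mule_ge0// lee_fin ?sqr_ge0.
  rewrite (_ : fubini_F _ _ = (fun s => \int[lebesgue_rV d]_y
    ((fun z => (g (cons_rV (s, z)) ^+ 2)%:E) \_ (cube d)) y))//.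
  apply/funext => s; apply: eq_integral => z _; rewrite /h patchE indicE/=.
  by case: (z \in cube d); rewrite ?mule1 ?mule0.
rewrite -ge0_integralZl//; last 2 first.
- by apply: measurable_funTS; exact: mF.
- by move=> s _; apply: integral_ge0 => z _; rewrite lee_fin sqr_ge0.
apply: ge0_le_integral => //.
- by move=> s _; rewrite lee_fin horner_exp sqr_ge0.
- apply/measurable_EFinP; apply: measurable_funTS.
  by apply: continuous_measurable_fun; exact: continuous_horner.
- by apply: measurable_funeM; apply: measurable_funTS; exact: mF.
- move=> s _; rewrite horner_exp -qE.
  exact: (IH (fun z => g (cons_rV (s, z)))).
Qed.

End nikolskii.

(** * Passing between [P] and Lebesgue measure *)

Section density.
Context {R : realType} (d : nat) (P : probability 'rV[R]_d R) (p : 'rV[R]_d -> R).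
Hypothesis P_density : has_density_on_cube P p.
Hypothesis p_min_gt0 : 0 < p_min p.
Hypothesis p_max_fin : has_ubound (p @` cube d).
Local Notation leb := (@lebesgue_rV R d).

Let cube0 : cube d (0 : 'rV[R]_d).
Proof. by move=> i; rewrite mxE lexx ler01. Qed.

Lemma le_p_min z : cube d z -> p_min p <= p z.
Proof.
move=> zc; apply: ge_inf; last by exists z.
(* Were the infimum not genuine, [inf] would take its default value [0], against [p_min_gt0]. *)
have [//|/inf_out p0] := pselect (has_inf (p @` cube d)).
  by move=> [].
by move: p_min_gt0; rewrite /p_min p0 ltxx.
Qed.

Lemma p_gt0 z : cube d z -> 0 < p z.
Proof. by move=> /le_p_min; apply: lt_le_trans. Qed.

Lemma ge_p_max z : cube d z -> p z <= p_max p.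
Proof. by move=> zc; apply: ub_le_sup => //; exists z. Qed.

Lemma c_p_ge z : cube d z -> 1 <= c_p p * p z.
Proof.
move=> zc; rewrite -ler_pdivrMr ?p_gt0// mul1r; apply: ub_le_sup; last by exists z.
(* The supremum defining [c_p] is genuine because the reciprocals are bounded by [(p_min p)^-1]. *)
exists (p_min p)^-1 => _ [y yc <-].
by rewrite lef_pV2 ?posrE ?p_gt0// le_p_min.
Qed.

Lemma c_p_gt0 : 0 < c_p p.
Proof.
by have := c_p_ge cube0; rewrite -(pmulr_lgt0 _ (p_gt0 cube0)); exact: lt_le_trans.
Qed.

Lemma lebesgue_rV_cube : leb (cube d) = 1%E.
Proof.
rewrite cubeE (@lebesgue_rV_box _ _ (fun=> `[0, 1]%classic))//.
by rewrite big1// => i _; rewrite lebesgue_measure_itv/= lte_fin ltr01 sube0.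
Qed.

Lemma bounded_integrable_cube (f : 'rV[R]_d -> R) M :
  measurable_fun (cube d) f -> (forall z, cube d z -> `|f z| <= M) ->
  leb.-integrable (cube d) (EFin \o f).
Proof.
move=> mf fM; apply: measurable_bounded_integrable => //.
- exact: measurable_cube.
- suff : (leb (cube d) < +oo)%E by [].
  by rewrite lebesgue_rV_cube ltry.
- exists M; split; first exact: num_real.
  by move=> y My z /= zc; rewrite (le_trans (fM _ zc))// ltW.
Qed.

Lemma within_continuous_bounded_cube (f : 'rV[R]_d -> R) :
  {within cube d, continuous f} -> exists M, forall z, cube d z -> `|f z| <= M.
Proof.
move=> cf; have cnf : {within cube d, continuous (fun z => `|f z|)}.
  by move=> z; apply: cvg_norm; exact: cf.
have [c _ cP] := EVT_max_rV (ex_intro _ _ cube0) (@compact_cube R d) cnf.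
by exists `|f c| => z zc; apply: cP; rewrite inE.
Qed.

Lemma dominates_P_lebesgue : P `<< leb.
Proof.
case: P_density => mp pE; apply/null_content_dominatesP => A mA A0.
rewrite pE//; apply: null_set_integral.
- by apply: measurableI => //; exact: measurable_cube.
- apply/measurable_EFinP.
  by apply: measurable_funS mp; [exact: measurable_cube|exact: subIsetr].
- apply/eqP; rewrite eq_le measure_ge0 andbT -A0 le_measure// inE//.
  by apply: measurableI => //; exact: measurable_cube.
Qed.

Local Open Scope ereal_scope.

(** The density is given on sets only. The Radon-Nikodym derivative of [P] has the same integral as
    [p] over every measurable subset of the cube, hence agrees with it almost everywhere there, and
    the change of variables extends this to functions. *)
Lemma integral_density (f : 'rV[R]_d -> R) :
  P.-integrable (cube d) (EFin \o f) ->
  \int[P]_(x in cube d) (f x)%:E = \int[leb]_(x in cube d) (f x * p x)%:E.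
Proof.
move=> intf; have mc := @measurable_cube R d; case: (P_density) => mp pE.
have mf := measurable_int _ intf.
rewrite -(Radon_Nikodym_change_of_variables dominates_P_lebesgue mc intf)/=.
set D := Radon_Nikodym _ _.
have intD : leb.-integrable setT D.
  by apply: Radon_Nikodym_integrable; exact: dominates_P_lebesgue.
have mD : measurable_fun (cube d) D.
  by apply: measurable_funTS; exact: measurable_int intD.
apply: ae_eq_integral => //.
- exact: emeasurable_funM.
- by apply/measurable_EFinP; apply: measurable_funM => //; exact/measurable_EFinP.
have : ae_eq leb (cube d) D (EFin \o p).
  apply: integral_ae_eq => //.
  - exact: integrableS intD.
  - exact/measurable_EFinP.
  - move=> E Ec mE; rewrite -Radon_Nikodym_integral//; last exact: dominates_P_lebesgue.
    by have := pE E mE; rewrite (setIidl Ec).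
by apply: filterS => x /= Dp /Dp ->; rewrite EFinM.
Qed.

Lemma integral_density1 : \int[leb]_(x in cube d) (p x)%:E = 1.
Proof.
have := P_density.2 setT measurableT; rewrite setTI => <-.
exact: probability_setT.
Qed.

(* [p] is bounded below, so a nonempty relatively open subset of the cube has
   positive probability. *)
Lemma ae_le_cube (f : 'rV[R]_d -> R) (B : R) :
  {within cube d, continuous f} -> {ae P, forall y, cube d y -> (f y <= B)%R} ->
  forall x, cube d x -> (f x <= B)%R.
Proof.
move=> cf [N [mN N0 fN]] x xc; rewrite leNgt; apply/negP => Bf.
have /subspace_continuousP/(_ x xc) cfx := cf.
have : (f @ within (cube d) (nbhs x)) [set r | (B < r)%R].
  by apply: cfx; apply: open_nbhs_nbhs; split => //=; exact: open_gt.
move=> /nbhs_ballP[e /= e0 eB].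
have mbc : measurable (ball x e `&` cube d).
  apply: measurableI; last exact: measurable_cube.
  by apply: open_measurable_rV; exact: ball_open.
have : P (ball x e `&` cube d) <= 0.
  rewrite -N0 le_measure ?inE// => y [xy yc]; apply: fN => /= /(_ yc).
  by rewrite leNgt => /negP; apply; exact: eB.
apply/negP; rewrite -ltNge P_density.2// -setIA setIid.
apply: (@lt_le_trans _ _ (\int[leb]_(z in ball x e `&` cube d) (p_min p)%:E)).
  by rewrite integral_cst// mule_gt0 ?lte_fin ?lebesgue_rV_ball_cube.
apply: ge0_le_integral => //.
- by move=> z _; rewrite lee_fin ltW.
- apply/measurable_EFinP.
  by apply: measurable_funS P_density.1; [exact: measurable_cube|exact: subIsetr].
- by move=> z [_ zc]; rewrite lee_fin le_p_min.
Qed.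

End density.

(** * Truncating the Gaussian kernel *)

Section coordwise_poly_theory.
Context {R : realType} {d : nat}.
Implicit Types (n m : nat) (f g : 'rV[R]_d -> R).

Lemma coordwise_polyW n m g : (n <= m)%N -> coordwise_poly n g -> coordwise_poly m g.
Proof.
by move=> nm pg x i; have [q sq qE] := pg x i; exists q => //; exact: leq_trans sq _.
Qed.

Lemma coordwise_poly_cst n (c : R) : coordwise_poly n (fun _ : 'rV[R]_d => c).
Proof.
move=> x i; exists c%:P; last by move=> s; rewrite hornerC.
by rewrite (leq_trans (size_polyC_leq1 _)).
Qed.

Lemma coordwise_poly_coord (j : 'I_d) :
  coordwise_poly 1 (fun x : 'rV[R]_d => x ord0 j).
Proof.
move=> x i; exists (if j == i then 'X else (x ord0 j)%:P).
  by case: ifP => _; rewrite ?size_polyX// (leq_trans (size_polyC_leq1 _)).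
by move=> s; rewrite mxE; case: ifP => _; rewrite ?hornerX ?hornerC.
Qed.

Lemma coordwise_polyD n f g : coordwise_poly n f -> coordwise_poly n g ->
  coordwise_poly n (fun x => f x + g x).
Proof.
move=> pf pg x i; have [q sq qE] := pf x i; have [r sr rE] := pg x i.
exists (q + r); last by move=> s; rewrite hornerD -qE -rE.
by rewrite (leq_trans (size_polyD _ _))// geq_max sq.
Qed.

Lemma coordwise_polyM n m f g : coordwise_poly n f -> coordwise_poly m g ->
  coordwise_poly (n + m) (fun x => f x * g x).
Proof.
move=> pf pg x i; have [q sq qE] := pf x i; have [r sr rE] := pg x i.
exists (q * r); last by move=> s; rewrite hornerM -qE -rE.
rewrite (leq_trans (size_polyMleq _ _))//.
by lia.
Qed.

End coordwise_poly_theory.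

(** * Kernels that separate into finite sums of products *)

Section separable_kernel.
Context {R : realType} {d : nat}.
Implicit Types (n m : nat) (b f g w : 'rV[R]_d -> R).

(** Integrating out [z] in a finite sum of products [b z * g x] leaves a linear combination of the
    functions [g]. Hence continuity and the degree bound in [x] pass to the integral, by induction
    on this predicate. *)
Inductive separable n : ('rV[R]_d -> 'rV[R]_d -> R) -> Prop :=
| separable_prod (b g : 'rV[R]_d -> R) : continuous b -> continuous g -> coordwise_poly n g ->
    separable n (fun z x => b z * g x)
| separableD F G : separable n F -> separable n G ->
    separable n (fun z x => F z x + G z x).

Lemma eq_separable n F G : (forall z x, F z x = G z x) -> separable n F -> separable n G.
Proof.
by move=> FG; rewrite (_ : F = G)//; apply/funext => z; apply/funext => x.
Qed.

Lemma separableW n m F : (n <= m)%N -> separable n F -> separable m F.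
Proof.
move=> nm; elim=> [b g cb cg pg|G H _ sG _ sH]; last exact: separableD.
by apply: separable_prod => //; exact: coordwise_polyW pg.
Qed.

Lemma separable_left n b : continuous b -> separable n (fun z _ => b z).
Proof.
move=> cb; apply: (@eq_separable _ (fun z _ => b z * 1)) => [z x|]; first exact: mulr1.
apply: (@separable_prod _ b (fun=> 1)); [exact: cb| |exact: coordwise_poly_cst].
exact: cst_continuous.
Qed.

Lemma separable_sum n (I : Type) (r : seq I) (F : I -> 'rV[R]_d -> 'rV[R]_d -> R) :
  (forall i, separable n (F i)) -> separable n (fun z x => \sum_(i <- r) F i z x).
Proof.
move=> sF; elim: r => [|i r IH].
  apply: (@eq_separable _ (fun _ _ => 0)) => [z x|]; first by rewrite big_nil.
  by apply: separable_left; exact: cst_continuous.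
apply: (@eq_separable _ (fun z x => F i z x + \sum_(i <- r) F i z x)) => [z x|].
  by rewrite big_cons.
exact: separableD.
Qed.

Lemma separableM n m F G : separable n F -> separable m G ->
  separable (n + m) (fun z x => F z x * G z x).
Proof.
move=> sF sG; elim: sF => [b g cb cg pg|F1 F2 _ s1 _ s2]; last first.
  by apply: eq_separable (separableD s1 s2) => z x; rewrite mulrDl.
elim: sG => [b' g' cb' cg' pg'|F1 F2 _ s1 _ s2]; last first.
  by apply: eq_separable (separableD s1 s2) => z x; rewrite mulrDr.
apply: (@eq_separable _ (fun z x => (b z * b' z) * (g x * g' x))) => [z x|].
  exact: mulrACA.
apply: separable_prod.
- by move=> z; apply: continuousM; [exact: cb|exact: cb'].
- by move=> z; apply: continuousM; [exact: cg|exact: cg'].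
- exact: coordwise_polyM.
Qed.

Lemma separableX n F j : separable n F -> separable (n * j) (fun z x => F z x ^+ j).
Proof.
move=> sF; elim: j => [|j IH].
  apply: (@eq_separable _ (fun _ _ => 1)) => [z x|]; first by rewrite expr0.
  by apply: separable_left; exact: cst_continuous.
by rewrite mulnS; apply: eq_separable (separableM sF IH) => z x; rewrite exprS.
Qed.

Lemma separable_sqr_dist :
  separable 2 (fun z x => \sum_(i < d) (z ord0 i - x ord0 i) ^+ 2).
Proof.
apply: separable_sum => i; apply: (@separableX 1 _ 2).
have ci : continuous (fun z : 'rV[R]_d => z ord0 i) by exact: coord_continuous.
apply: separableD; first exact: separable_left.
apply: (@eq_separable _ (fun z x => (-1) * x ord0 i)) => [z x|]; first by rewrite mulN1r.
by apply: separable_prod; [exact: cst_continuous|exact: ci|exact: coordwise_poly_coord].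
Qed.

Definition gaussian_trunc (sigma : R) m (z x : 'rV[R]_d) : R :=
  exp_trunc m (- (sigma * \sum_(i < d) (z ord0 i - x ord0 i) ^+ 2)).

(** The summand of index [j < m] is a multiple of the [j]-th power of the squared distance, so its
    degree in each coordinate of [x] is at most [2 j <= 2 (m - 1)]. *)
Lemma separable_gaussian_trunc sigma m :
  separable (2 * m.-1) (gaussian_trunc sigma m).
Proof.
rewrite /gaussian_trunc /exp_trunc; apply: separable_sum => j.
have := separableX j separable_sqr_dist.
move=> /(separableW (_ : 2 * j <= 2 * m.-1)%N) => sj.
have {}sj : separable (2 * m.-1)
    (fun z x => (\sum_(i < d) (z ord0 i - x ord0 i) ^+ 2) ^+ j).
  by apply: sj; rewrite leq_mul2l -ltnS (leq_trans (ltn_ord j))// leqSpred.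
have := separableM (@separable_left 0 (fun=> (- sigma) ^+ j / j`!%:R) _) sj.
rewrite add0n => H; apply: (eq_separable _ (H _)) => [z x|]; last exact: cst_continuous.
by rewrite -mulNr exprMn mulrAC.
Qed.

Lemma separable_continuous_left n F x : separable n F -> continuous (F^~ x).
Proof.
elim=> [b g cb _ _ z|G H _ cG _ cH z]; last by apply: continuousD; [exact: cG|exact: cH].
by apply: continuousM; [exact: cb|exact: cst_continuous].
Qed.

Lemma integrable_cubeM f w : {within cube d, continuous f} ->
  (lebesgue_rV d).-integrable (cube d) (EFin \o w) ->
  (lebesgue_rV d).-integrable (cube d) (EFin \o (fun z => f z * w z)).
Proof.
move=> cf iw; have mc := @measurable_cube R d.
have [M fM] := within_continuous_bounded_cube cf.
apply: (eq_integrable mc ((EFin \o f) \* (EFin \o w))%E) => //.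
apply: integrableMr => //; first exact: within_continuous_measurable_rV.
exists M; split; first exact: num_real.
by move=> y My z /= zc; rewrite (le_trans (fM _ zc))// ltW.
Qed.

Lemma coordwise_poly_separable_integral n F w : separable n F ->
  (lebesgue_rV d).-integrable (cube d) (EFin \o w) ->
  let Q x := \int[lebesgue_rV d]_(z in cube d) (F z x * w z) in
  continuous Q /\ coordwise_poly n Q.
Proof.
move=> sF iw; have mc := @measurable_cube R d.
elim: sF => [b g cb cg pg|G H sG [cG pG] sH [cH pH]] /=.
  rewrite (_ : (fun x => _) =
    fun x => (\int[lebesgue_rV d]_(z in cube d) (b z * w z)) * g x); last first.
    apply/funext => x; rewrite -RintegralZr//; last first.
      by apply: integrable_cubeM => //; exact: continuous_subspaceT.
    by apply: eq_Rintegral => z _; rewrite mulrAC.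
  split.
    by move=> x; exact: (continuousM (@cst_continuous _ _ _ x) (cg x)).
  rewrite -(add0n n); apply: coordwise_polyM => //; exact: coordwise_poly_cst.
rewrite (_ : (fun x => _) =
  fun x => \int[lebesgue_rV d]_(z in cube d) (G z x * w z) +
           \int[lebesgue_rV d]_(z in cube d) (H z x * w z)); last first.
  apply/funext => x; rewrite -RintegralD//.
  - by apply: eq_Rintegral => z _; rewrite mulrDl.
  - apply: integrable_cubeM => //; apply: continuous_subspaceT.
    exact: separable_continuous_left sG.
  - apply: integrable_cubeM => //; apply: continuous_subspaceT.
    exact: separable_continuous_left sH.
split; last exact: coordwise_polyD.
by move=> x; exact: (continuousD (cG x) (cH x)).
Qed.

End separable_kernel.

(** * Sup bound for an eigenfunction at a given truncation order *)

Section eigenfunction_bound.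
Context {R : realType} (d : nat) (P : probability 'rV[R]_d R) (p : 'rV[R]_d -> R).
Hypothesis P_density : has_density_on_cube P p.
Hypothesis p_min_gt0 : 0 < p_min p.
Hypothesis p_max_fin : has_ubound (p @` cube d).
Local Notation leb := (@lebesgue_rV R d).

Lemma sqr_dist_cube (x y : 'rV[R]_d) : cube d x -> cube d y ->
  0 <= \sum_(i < d) (x ord0 i - y ord0 i) ^+ 2 <= d%:R.
Proof.
move=> xc yc; rewrite sumr_ge0/=; last by move=> i _; exact: sqr_ge0.
rewrite -[leRHS]mulr1 mulr_natl -[d in leRHS]card_ord -sumr_const; apply: ler_sum => i _.
have [? ?] := xc i; have [? ?] := yc i.
by rewrite -ler_sqrt// sqrtr_sqr sqrtr1 ler_norml; apply/andP; split; lra.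
Qed.

Lemma gaussian_trunc_error (sigma a : R) m (x y : 'rV[R]_d) :
  0 < sigma -> 1 <= a -> cube d x -> cube d y ->
  `|gaussian_kernel sigma x y - gaussian_trunc sigma m x y| <=
  a ^- m * expR (a * (sigma * d%:R)).
Proof.
move=> s0 a1 xc yc; have /andP[D0 Dd] := sqr_dist_cube xc yc.
rewrite /gaussian_kernel /gaussian_trunc mulNr.
apply: le_trans (exp_trunc_error m _ a1) _; first by rewrite mulr_ge0// ltW.
have a0 : 0 < a by exact: lt_le_trans a1.
rewrite ler_wpM2l ?invr_ge0 ?exprn_ge0 ?(ltW a0)// ler_expR.
by rewrite !ler_pM2l.
Qed.

Variables (sigma lambda a : R) (m : nat) (phi : 'rV[R]_d -> R).
Hypothesis sigma_gt0 : 0 < sigma.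
Hypothesis lambda_gt0 : 0 < lambda.
Hypothesis a_ge1 : 1 <= a.
Hypothesis cphi : {within cube d, continuous phi}.
Hypothesis phi_norm1 : (\int[P]_(x in cube d) (phi x * phi x)%:E = 1)%E.
Hypothesis phi_eigen : {ae P, forall y,
  kernel_operator p (gaussian_kernel sigma) phi y = lambda * phi y}.
Hypothesis small : a ^- m * expR (a * (sigma * d%:R)) <= lambda.

Let eps := a ^- m * expR (a * (sigma * d%:R)).
Let w z := phi z * p z.
Let Q x := \int[leb]_(z in cube d) (gaussian_trunc sigma m z x * w z).

Let eps_ge0 : 0 <= eps.
Proof.
by rewrite mulr_ge0 ?expR_ge0// invr_ge0 exprn_ge0// (le_trans ler01).
Qed.

Let mc := @measurable_cube R d.

Let mp : measurable_fun (cube d) p := P_density.1.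

Let mphi : measurable_fun (cube d) phi.
Proof. exact: within_continuous_measurable_rV. Qed.

Let intD (f g : 'rV[R]_d -> R) : leb.-integrable (cube d) (EFin \o f) ->
  leb.-integrable (cube d) (EFin \o g) ->
  leb.-integrable (cube d) (EFin \o (fun z => f z + g z)).
Proof. by move=> fi gi; exact: (integrableD mc fi gi). Qed.

Let intB (f g : 'rV[R]_d -> R) : leb.-integrable (cube d) (EFin \o f) ->
  leb.-integrable (cube d) (EFin \o g) ->
  leb.-integrable (cube d) (EFin \o (fun z => f z - g z)).
Proof. by move=> fi gi; exact: (integrableB mc fi gi). Qed.

Let intZ (k : R) (f : 'rV[R]_d -> R) : leb.-integrable (cube d) (EFin \o f) ->
  leb.-integrable (cube d) (EFin \o (fun z => k * f z)).
Proof. by move=> fi; exact: (integrableZl mc k fi). Qed.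

Let integrable_density : leb.-integrable (cube d) (EFin \o p).
Proof.
apply: (bounded_integrable_cube (M := p_max p)) => // z zc.
by rewrite ger0_norm ?ge_p_max// ltW// p_gt0.
Qed.

Let integrable_w : leb.-integrable (cube d) (EFin \o w).
Proof. exact: integrable_cubeM. Qed.

Let cphi2 : {within cube d, continuous (fun z => phi z * phi z)}.
Proof. by move=> z; apply: continuousM; exact: cphi. Qed.

Let integrable_phi2p : leb.-integrable (cube d) (EFin \o (fun z => phi z * phi z * p z)).
Proof. exact: integrable_cubeM. Qed.

Let integral_phi2p : \int[leb]_(z in cube d) (phi z * phi z * p z) = 1.
Proof.
rewrite /Rintegral -(integral_density P_density) ?phi_norm1//.
have [M phiM] := within_continuous_bounded_cube cphi2.
apply: measurable_bounded_integrable => //.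
- by rewrite (le_lt_trans (probability_le1 P mc))// ltry.
- exact: measurable_funM.
- exists M; split; first exact: num_real.
  by move=> y My z /= zc; rewrite (le_trans (phiM _ zc))// ltW.
Qed.

Let integral_p : \int[leb]_(z in cube d) p z = 1.
Proof. by rewrite /Rintegral (integral_density1 P_density). Qed.

(** Pointwise [|phi| <= (phi^2 + 1) / 2]; after multiplication by [p], the two halves integrate to
    [1 / 2] each. *)
Let integral_normw : \int[leb]_(z in cube d) `|w z| <= 1.
Proof.
apply: (@le_trans _ _ (\int[leb]_(z in cube d) (2^-1 * (phi z * phi z * p z) + 2^-1 * p z))).
  apply: le_Rintegral => //.
  - exact: integrable_norm.
  - by apply: intD; exact: intZ.
  - move=> z zc; rewrite /w normrM (ger0_norm (ltW (p_gt0 p_min_gt0 zc))).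
    rewrite mulrA -mulrDl ler_wpM2r ?(ltW (p_gt0 p_min_gt0 zc))//.
    have := sqr_ge0 (`|phi z| - 1).
    rewrite sqrrB1 real_normK ?num_real// -expr2; lra.
rewrite RintegralD//; [|exact: intZ..].
rewrite !RintegralZl// integral_phi2p integral_p; lra.
Qed.

Let separable_trunc := @separable_gaussian_trunc R d sigma m.

Let Q_poly := coordwise_poly_separable_integral separable_trunc integrable_w.

Let gaussian_continuous_left y : continuous (fun z : 'rV[R]_d => gaussian_kernel sigma z y).
Proof.
have := @separable_continuous_left _ _ _ _ y (@separable_sqr_dist R d) => cD z.
rewrite /gaussian_kernel.
apply: (@continuous_comp _ _ _
  (fun z : 'rV[R]_d => - sigma * \sum_(i < d) (z ord0 i - y ord0 i) ^+ 2) expR).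
  exact: (continuousM (@cst_continuous _ _ _ z) (cD z)).
exact: continuous_expR.
Qed.

(** The truncation error is at most [eps] uniformly on the cube, and it is integrated against [w],
    whose [L^1] norm is at most [1]. *)
Let operator_approx y : cube d y ->
  `|kernel_operator p (gaussian_kernel sigma) phi y - Q y| <= eps.
Proof.
move=> yc; rewrite /kernel_operator /Q.
have ik : leb.-integrable (cube d)
    (EFin \o (fun z => gaussian_kernel sigma z y * w z)).
  apply: integrable_cubeM => //; apply: continuous_subspaceT.
  exact: gaussian_continuous_left.
have it : leb.-integrable (cube d)
    (EFin \o (fun z => gaussian_trunc sigma m z y * w z)).
  apply: integrable_cubeM => //; apply: continuous_subspaceT.
  exact: separable_continuous_left separable_trunc.
under eq_Rintegral do rewrite -mulrA -/(w _).
rewrite -RintegralB//.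
apply: le_trans (le_normr_Rintegral _ _) _ => //; first exact: intB.
apply: (@le_trans _ _ (\int[leb]_(z in cube d) (eps * `|w z|))).
  apply: le_Rintegral => //.
  - by apply: integrable_norm => //; exact: intB.
  - by apply: intZ; exact: integrable_norm.
  - move=> z zc; rewrite -mulrBl normrM ler_wpM2r//.
    exact: gaussian_trunc_error.
rewrite RintegralZl//; last exact: integrable_norm.
by rewrite ler_piMr.
Qed.

Let pointwise_approx y : cube d y -> `|lambda * phi y - Q y| <= eps.
Proof.
move: y; apply: (ae_le_cube P_density) => //.
  have cQ : {within cube d, continuous Q}.
    by apply: continuous_subspaceT; exact: Q_poly.1.
  have cF : {within cube d, continuous (fun y => lambda * phi y - Q y)}.
    move=> y; apply: cvgB; last exact: cQ.
    by apply: cvgM; [exact: cvg_cst|exact: cphi].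
  by move=> y; apply: cvg_norm; exact: cF.
by apply: filterS phi_eigen => y <- yc; exact: operator_approx.
Qed.

(** The factor [c_p p * p z >= 1] trades Lebesgue measure for [P]. Then [Q^2 <= 2 (lambda phi)^2 + 2
    (lambda phi - Q)^2 <= 2 lambda^2 phi^2 + 2 lambda^2], and [phi^2] and [1] both have [P]-integral
    [1]. *)
Let Q_norm : (\int[leb]_(z in cube d) (Q z ^+ 2)%:E <= (4 * c_p p * lambda ^+ 2)%:E)%E.
Proof.
have mQ : measurable_fun (cube d) Q.
  apply: within_continuous_measurable_rV => //; apply: continuous_subspaceT.
  exact: Q_poly.1.
pose G z := c_p p * (2 * lambda ^+ 2) * (phi z * phi z * p z) +
  c_p p * (2 * lambda ^+ 2) * p z.
have iG : leb.-integrable (cube d) (EFin \o G).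
  by apply: intD; exact: intZ.
have -> : 4 * c_p p * lambda ^+ 2 = \int[leb]_(z in cube d) G z.
  rewrite RintegralD//; [|exact: intZ..].
  by rewrite !RintegralZl// integral_phi2p integral_p; ring.
rewrite /Rintegral fineK; last exact: integrable_fin_num.
apply: ge0_le_integral => //.
- by move=> z _; rewrite lee_fin sqr_ge0.
- by apply/measurable_EFinP; exact: measurable_funX.
- exact: measurable_int iG.
- move=> z zc; rewrite lee_fin.
  apply: (@le_trans _ _ (Q z ^+ 2 * (c_p p * p z))).
    by rewrite ler_peMr ?sqr_ge0// c_p_ge.
  have r2 : (lambda * phi z - Q z) ^+ 2 <= lambda ^+ 2.
    rewrite -[leLHS]real_normK ?num_real// ler_sqr ?nnegrE ?(ltW lambda_gt0)//.
    exact: le_trans (pointwise_approx zc) small.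
  have Q2 : Q z ^+ 2 <= 2 * lambda ^+ 2 * (phi z * phi z) + 2 * lambda ^+ 2.
    (* With [u = lambda * phi z], this square equals [2 u^2 + 2 (u - Q)^2 - Q^2]. *)
    have := sqr_ge0 (2 * (lambda * phi z) - Q z).
    move: r2; rewrite !expr2; lra.
  have cpp : 0 <= c_p p * p z by rewrite (le_trans ler01)// c_p_ge.
  by rewrite /G; have := ler_wpM2r cpp Q2; lra.
Qed.

(** The bound on [Q] and the approximation error are both proportional to [lambda], which therefore
    cancels; the error contributes the summand [1]. *)
Lemma eigenfunction_bound x : cube d x ->
  `|phi x| <= 2 * Num.sqrt (c_p p) * (2 * m.-1).+1%:R ^+ d + 1.
Proof.
move=> xc; set N : R := (2 * m.-1).+1%:R.
have mQ : measurable_fun setT Q.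
  apply: within_continuous_measurable_rV => //; apply: continuous_subspaceT.
  exact: Q_poly.1.
have := coordwise_poly_nikolskii mQ Q_poly.2 xc; rewrite -/N => Qx.
have {}Qx : Q x ^+ 2 <= (2 * Num.sqrt (c_p p) * N ^+ d * lambda) ^+ 2.
  rewrite -lee_fin; apply: (le_trans Qx).
  apply: (@le_trans _ _ (((N ^+ 2) ^+ d)%:E * (4 * c_p p * lambda ^+ 2)%:E)%E).
    by rewrite lee_wpmul2l ?lee_fin ?exprn_ge0// ?sqr_ge0// Q_norm.
  rewrite -EFinM lee_fin -exprM mulnC exprM.
  have <- := sqr_sqrtr (ltW (c_p_gt0 p_min_gt0)).
  rewrite sqrtr_sqr ger0_norm ?sqrtr_ge0// le_eqVlt; apply/orP; left; apply/eqP.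
  by move: (Num.sqrt _) (N ^+ d) => s M; ring.
have B0 : 0 <= 2 * Num.sqrt (c_p p) * N ^+ d * lambda.
  by rewrite !mulr_ge0 ?sqrtr_ge0 ?exprn_ge0 ?(ltW lambda_gt0)// /N.
have {}Qx : `|Q x| <= 2 * Num.sqrt (c_p p) * N ^+ d * lambda.
  by rewrite -ler_sqr ?nnegrE// -normrX ger0_norm ?sqr_ge0.
rewrite -(ler_pM2r lambda_gt0) mulrDl mul1r.
rewrite -[X in _ * X <= _](gtr0_norm lambda_gt0) -normrM mulrC.
have := pointwise_approx xc; rewrite -/eps => h.
have : eps <= lambda := small.
have := ler_normD (lambda * phi x - Q x) (Q x); rewrite subrK; lra.
Qed.

End eigenfunction_bound.

(** * Choice of the truncation order *)

Section truncation_order.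
Context {R : realType} (d : nat) (sigma t : R).
Hypothesis sigma_gt0 : 0 < sigma.
Hypothesis t_ge : expR 1 <= t.
Let cs := c_sigma d sigma.

(** The successor of the integer part: the order itself is at least [3 * cs * t / 2], as the error
    estimate requires, while its predecessor, which governs the degree, is at most that. *)
Definition truncation_order : nat := (Num.truncn (3 * cs * t / 2)).+1.

Let cs_ge1 : 1 <= cs. Proof. by rewrite le_max lexx. Qed.

Let t_ge0 : 0 <= t. Proof. exact: le_trans (expR_ge0 _) t_ge. Qed.

Let order_ge0 : 0 <= 3 * cs * t / 2.
Proof. by rewrite !mulr_ge0// (le_trans ler01). Qed.

Lemma truncation_order_le :
  (2 * truncation_order.-1).+1%:R <= 3 * cs * t + 2 :> R.
Proof.
have : (Num.truncn (3 * cs * t / 2))%:R <= 3 * cs * t / 2.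
  by have /andP[] := truncn_itv order_ge0.
by rewrite /truncation_order [_.-1]/= -[(2 * _).+1%:R]natr1 natrM; lra.
Qed.

(** Rankin's bound with [a = expR 2]. The term [- 2 m] of the exponent is at most [- 3 cs t]; since
    [2 e sigma d <= cs] and [e <= t], the other term is at most [cs t / 2]. The total is at most
    [- 5 / 2 cs t], hence at most [- 2 t] because [cs >= 1]. *)
Lemma truncation_order_small :
  expR 2 ^- truncation_order * expR (expR 2 * (sigma * d%:R)) <= expR (- (2 * t)).
Proof.
have mt : 3 * cs * t / 2 <= truncation_order%:R.
  by have /andP[_ /ltW] := truncn_itv order_ge0.
rewrite -expRM_natl -expRN -expRD ler_expR.
have t1 : t <= cs * t by rewrite ler_peMl.
have sd : expR 2 * (sigma * d%:R) <= cs * t / 2.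
  have -> : expR 2 = expR 1 * expR 1 :> R by rewrite -expRD.
  have c2 : 2 * expR 1 * sigma * d%:R <= cs by rewrite le_max lexx orbT.
  have sd0 : 0 <= expR 1 * (sigma * d%:R).
    by rewrite !mulr_ge0 ?expR_ge0// ltW.
  have := ler_wpM2l sd0 t_ge; have := ler_wpM2r t_ge0 c2; lra.
have key (n v q u : R) : 0 <= u -> u <= q -> 3 * q / 2 <= n -> v <= q / 2 ->
    - (n * 2) + v <= - (2 * u) by lra.
by apply: key t_ge0 t1 _ sd; rewrite mulrA.
Qed.

End truncation_order.

(** * From the eigenvalue lower bound to the sup bound *)

Theorem theorem3p7 (R : realType) (d : nat) (sigma : R)
    (C c_dsigma : R)
    (P : probability 'rV[R]_d R) (p : 'rV[R]_d -> R)
    (mu : nat -> R) (phi : nat -> 'rV[R]_d -> R)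
    (d_ge1 : (1 <= d)%N) (sigma_gt0 : 0 < sigma)
    (P_density : has_density_on_cube P p)
    (p_min_gt0 : 0 < p_min p)
    (p_max_fin : has_ubound (p @` cube d))
    (mercer : mercer_decomposition P p (gaussian_kernel sigma) mu phi)
    (C_gt0 : 0 < C) (c_dsigma_gt0 : 0 < c_dsigma)
    (mu_lower : forall l, (1 <= l)%N ->
      p_min p ^+ 2 / p_max p ^+ 2 * C
        * expR (- c_dsigma * (l + d)%:R `^ (2 / d%:R)) <= mu l) :
  forall l, (1 <= l)%N -> forall x, cube d x ->
    `|phi l x| <=
      Num.sqrt (18 * c_p p)
        * Num.max (h_bound sigma p C c_dsigma l)
            (Num.max ((3 * c_sigma d sigma * expR 1 + 2) ^+ d)
               ((3 * c_sigma d sigma * (d%:R * c_max d sigma (c_p p)) + 2) ^+ d))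
        + Num.sqrt 2.
Proof.
move=> l l1 x xc; have {mu_lower} mul := mu_lower l l1.
set L := _ `^ _ in mul.
set B := p_min p ^+ 2 / p_max p ^+ 2 * C in mul.
have p_max_gt0 : 0 < p_max p.
  exact: lt_le_trans (p_gt0 p_min_gt0 xc) (ge_p_max p_max_fin xc).
have B_gt0 : 0 < B by rewrite mulr_gt0// divr_gt0// exprn_gt0.
(* [T] is the quantity whose positive part enters [h_bound]; [expR (- (2 * T))] is one ninth of the
   lower bound on [mu l]. *)
set T := 2^-1 * ln 9 - 2^-1 * ln B + 2^-1 * c_dsigma * L.
have eT : expR (- (2 * T)) <= mu l.
  rewrite (_ : - (2 * T) = ln B + (- c_dsigma * L) - ln 9); last by rewrite /T; lra.
  rewrite !expRD expRN !lnK ?posrE//; apply: le_trans mul.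
  by rewrite ler_pdivrMr// ler_peMr ?ler1n// mulr_ge0 ?expR_ge0// ltW.
have mu_gt0 : 0 < mu l by apply: lt_le_trans eT; exact: expR_gt0.
(* The maximum with [0] gives the positive part in [h_bound], and the maximum with [expR 1] meets
   the requirement of the truncation order; according to which is larger, [N ^+ d] falls under the
   first or the second entry of the maximum [M]. *)
pose t := Num.max (Num.max T 0) (expR 1).
have t_ge : expR 1 <= t by rewrite le_max lexx orbT.
have small : expR 2 ^- truncation_order d sigma t * expR (expR 2 * (sigma * d%:R)) <= mu l.
  apply: le_trans (truncation_order_small d sigma_gt0 t_ge) (le_trans _ eT).
  by rewrite ler_expR lerN2 ler_pM2l// /t !le_max lexx.
have phi1 : (\int[P]_(x in cube d) (phi l x * phi l x)%:E = 1)%E.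
  by rewrite (mercer_orthonormal mercer l1 l1) eqxx.
have a1 : 1 <= expR 2 :> R by rewrite -expR0 ler_expR.
have := eigenfunction_bound P_density p_min_gt0 p_max_fin sigma_gt0 mu_gt0 a1
  (mercer_continuous mercer l1) phi1 (mercer_eigen mercer l1) small xc.
set N : R := (2 * _).+1%:R => bound.
have cs0 : 0 <= 3 * c_sigma d sigma by rewrite mulr_ge0// le_max ler01.
set M := Num.max (h_bound _ _ _ _ _) _.
have NM : N ^+ d <= M.
  apply: (@le_trans _ _ ((3 * c_sigma d sigma * t + 2) ^+ d)).
    have N_le : N <= 3 * c_sigma d sigma * t + 2 by exact: truncation_order_le.
    by apply: lerXn2r => //; rewrite nnegrE ?(le_trans _ N_le)// /N ler0n.
  rewrite /M /h_bound -/B -/L -/T /t.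
  by case: (leP (Num.max T 0) (expR 1)) => _; rewrite !le_max lexx ?orbT.
have M0 : 0 <= M by apply: le_trans NM; rewrite exprn_ge0.
(* The remaining slack is [1 <= sqrt 2] and [2 sqrt c_p = sqrt (4 c_p) <= sqrt (18 c_p)]. *)
apply: (le_trans bound); apply: lerD; last by rewrite -[leLHS]sqrtr1 ler_sqrt// ler1n.
have cp0 := ltW (c_p_gt0 p_min_gt0).
apply: ler_pM NM; rewrite ?mulr_ge0 ?sqrtr_ge0 ?exprn_ge0//.
have -> : 2 * Num.sqrt (c_p p) = Num.sqrt (4 * c_p p).
  by rewrite sqrtrM// (_ : 4 = 2 ^+ 2) ?sqrtr_sqr ?ger0_norm// -natrX.
by rewrite ler_wsqrtr// ler_wpM2r// ler_nat.
Qed.
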